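(* Every PID is a Dedekind domain.
   Context: A PID is an integral domain all of whose ideals are principal. A Dedekind domain is an integral domain that is Noetherian, integrally closed in its fraction field, and in which every nonzero prime ideal is maximal (fields are regarded as Dedekind domains). *)

(* Defs.v *)
From mathcomp Require Import all_boot all_algebra.
From mathcomp Require Import fraction.
From mathcomp Require Import classical_sets.

Set Implicit Arguments.
Unset Strict Implicit.
Unset Printing Implicit Defensive.

Import GRing.Theory.
Local Open Scope classical_set_scope.
Local Open Scope ring_scope.

(* Ideals are arbitrary Prop-valued subsets, and the unit ideal is an ideal;
   [idealr_closed] from [ring_quotient] covers only proper ideals given by
   boolean predicates. *)
Definition is_ideal (R : idomainType) (I : set R) : Prop :=
  [/\ I 0,
      forall x y, I x -> I y -> I (x + y)
    & forall a x, I x -> I (a * x)].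

Definition is_principal (R : idomainType) (I : set R) : Prop :=
  exists a : R, I = [set a * r | r in [set: R]].

Definition is_prime_ideal (R : idomainType) (P : set R) : Prop :=
  [/\ is_ideal P,
      P <> [set: R]
    & forall x y, P (x * y) -> P x \/ P y].

Definition is_maximal_ideal (R : idomainType) (M : set R) : Prop :=
  [/\ is_ideal M,
      M <> [set: R]
    & forall J : set R, is_ideal J -> M `<=` J -> J = M \/ J = [set: R]].

Definition is_PID (R : idomainType) : Prop :=
  forall I : set R, is_ideal I -> is_principal I.

(* Ascending chain condition on ideals. *)
Definition is_noetherian (R : idomainType) : Prop :=
  forall I : nat -> set R,
    (forall n, is_ideal (I n)) ->
    (forall n, I n `<=` I n.+1) ->
    exists N : nat, forall n : nat, (N <= n)%N -> I n = I N.

Definition is_integrally_closed (R : idomainType) : Prop :=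
  forall z : {fraction R},
    integralOver (@tofrac R) z -> exists r : R, z = tofrac r.

Definition is_dedekind (R : idomainType) : Prop :=
  [/\ is_noetherian R,
      is_integrally_closed R
    & forall P : set R,
        is_prime_ideal P -> P <> [set 0] -> is_maximal_ideal P].

(* Main.v *)
Require Import Defs.
From mathcomp Require Import all_boot all_algebra.
From mathcomp Require Import fraction generic_quotient classical_sets.

Set Implicit Arguments.
Unset Strict Implicit.
Unset Printing Implicit Defensive.

(** The three Dedekind conditions come from three uses of a generator.

    Chains: the union of an ascending chain of ideals is an ideal, and the
    stage of the chain at which a generator of the union appears already
    contains the whole union ([pid_noetherian]).

    Integral closure: a generator of the ideal [(n, d)] is a common divisor of
    [n] and [d] and a combination of them, so every fraction can be written
    [n / d] with [n * u + d * v = 1] ([pid_reduced_fraction]).  Dividing this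
    relation by [d] gives [1 / d = u * (n / d) + v]; hence [1 / d] is integral
    as soon as [n / d] is.  But the inverse of an element [d] can be integral
    only if it lies in the ring: clearing denominators in a monic equation of
    degree [n + 1] for [1 / d] by [d ^ n] expresses [1 / d] as a combination of
    powers of [d] ([integral_inv_in_ring]).

    Primes: if [(p)] is a nonzero prime and [(p) <= (a)], then [p = a * b], and
    primality puts [a] in [(p)], so that the two ideals agree, or [b] in [(p)],
    so that [a] is a unit ([pid_prime_maximal]). *)

Import GRing.Theory.
Local Open Scope classical_set_scope.
Local Open Scope ring_scope.

Lemma ideal_chain_mono (R : idomainType) (I : nat -> set R) :
  (forall n, I n `<=` I n.+1) -> forall m n, (m <= n)%N -> I m `<=` I n.
Proof.
move=> incI m n /subnK <-; elim: (n - m)%N => [|k IHk] //.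
by rewrite addSn; apply: subset_trans (incI _).
Qed.

(** Two members of the union lie in a common stage because the stages are
    nested. *)
Lemma ideal_chain_union (R : idomainType) (I : nat -> set R) :
  (forall n, is_ideal (I n)) -> (forall n, I n `<=` I n.+1) ->
  is_ideal [set x | exists n, I n x].
Proof.
move=> idI /ideal_chain_mono incI; split=> [|x y [m Imx] [n Iny]|a x [n Inx]].
- by exists 0%N; case: (idI 0%N).
- exists (maxn m n); case: (idI (maxn m n)) => _ addI _.
  by apply: addI; [apply: incI Imx; apply: leq_maxl
                  |apply: incI Iny; apply: leq_maxr].
- by exists n; case: (idI n) => _ _; apply.
Qed.

Lemma pid_noetherian (R : idomainType) : is_PID R -> is_noetherian R.
Proof.
move=> pidR I idI incI.
have [a defU] := pidR _ (ideal_chain_union idI incI).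
have [N INa] : [set x | exists n, I n x] a.
  by rewrite defU; exists 1; rewrite ?mulr1.
exists N => n leNn; apply/seteqP; split; last exact: ideal_chain_mono leNn.
move=> x Inx.
have : [set x | exists n, I n x] x by exists n.
rewrite defU => -[r _ <-].
by rewrite mulrC; case: (idI N) => _ _; apply.
Qed.

Lemma pid_prime_maximal (R : idomainType) (P : set R) :
  is_PID R -> is_prime_ideal P -> P <> [set 0] -> is_maximal_ideal P.
Proof.
move=> pidR [idP PnT primeP] Pn0; split=> // J idJ sPJ.
have [p defP] := pidR P idP; have [a defJ] := pidR J idJ.
have nz_p : p != 0.
  apply/eqP=> p0; apply: Pn0; rewrite defP p0; apply/seteqP; split=> x /=.
    by case=> r _ <-; rewrite mul0r.
  by move=> ->; exists 0; rewrite ?mulr0.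
have Pp : P p by rewrite defP; exists 1; rewrite ?mulr1.
have := sPJ p Pp; rewrite {1}defJ => -[b _ def_p].
case: (primeP a b); first by rewrite def_p.
- move=> Pa; left; apply/seteqP; split=> // x; rewrite defJ => -[r _ <-].
  by rewrite mulrC; case: idP => _ _; apply.
- rewrite {1}defP => -[c _ def_b]; right; apply/seteqP; split=> // x _.
  have ac1 : a * c = 1.
    by apply: (mulfI nz_p); rewrite mulrCA def_b def_p mulr1.
  by rewrite defJ; exists (c * x); rewrite // mulrA ac1 mul1r.
Qed.

(** Dividing numerator and denominator by a generator [g] of the ideal they
    span makes them coprime: cancelling [g] in the relation that expresses it
    as a combination of the two leaves [1]. *)
Lemma pid_reduced_fraction (R : idomainType) (z : {fraction R}) :
  is_PID R ->
  exists n d u v : R,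
    [/\ d != 0, n * u + d * v = 1 & z = tofrac n / tofrac d].
Proof.
move=> pidR.
have [n [d [nz_d ->]]] :
    exists n d : R, d != 0 /\ z = tofrac n / tofrac d.
  elim/quotW: z => x; exists \n_x, \d_x; split; first exact: denom_ratioP.
  have nz_d : tofrac \d_x != 0 by rewrite tofrac_eq0 denom_ratioP.
  apply: (mulIf nz_d); rewrite divfK //.
  (* On representatives the claim is the cross-multiplication defining the
     quotient; [!piE] exposes it once the field product is unfolded. *)
  rewrite /GRing.mul /= !piE; apply/eqmodP.
  rewrite /= FracField.equivfE /FracField.mulf.
  by rewrite !numden_Ratio ?mulf_neq0 ?oner_eq0 ?denom_ratioP // !mulr1 mulrC.
have [|g defI] := pidR [set x | exists u v, x = n * u + d * v].
  split=> [|x y [u [v ->]] [u' [v' ->]]|a x [u [v ->]]].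
  - by exists 0, 0; rewrite !mulr0 addr0.
  - by exists (u + u'), (v + v'); rewrite !mulrDr addrACA.
  - by exists (a * u), (a * v); rewrite mulrDr !(mulrCA a).
have [n' _ def_n] : [set g * r | r in [set: R]] n.
  by rewrite -defI; exists 1, 0; rewrite mulr1 mulr0 addr0.
have [d' _ def_d] : [set g * r | r in [set: R]] d.
  by rewrite -defI; exists 0, 1; rewrite mulr1 mulr0 add0r.
have [u [v def_g]] : [set x | exists u v, x = n * u + d * v] g.
  by rewrite defI; exists 1; rewrite ?mulr1.
have [nz_g nz_d'] : g != 0 /\ d' != 0.
  by apply/andP; rewrite -negb_or -mulf_eq0 def_d.
exists n', d', u, v; split=> //.
  by apply: (mulfI nz_g); rewrite mulrDr !mulrA def_n def_d -def_g mulr1.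
by rewrite -def_n -def_d !rmorphM /= -mulf_div divff ?mul1r // tofrac_eq0.
Qed.

(** With [w = 1 / d], multiplying [w ^ (n + 1) + ... + p_0 = 0] by [d ^ n]
    leaves the leading term equal to [w] and turns every other [p_i * w ^ i]
    into [p_i * d ^ (n - i)], an element of the ring. *)
Lemma integral_inv_in_ring (R : idomainType) (K : fieldType)
    (f : {rmorphism R -> K}) (d : R) :
  f d != 0 -> integralOver f (f d)^-1 -> exists r, (f d)^-1 = f r.
Proof.
move=> nz_d [p mon_p /rootP].
rewrite horner_coef size_map_poly_id0; last first.
  by rewrite (monicP mon_p) rmorph1 oner_eq0.
have : p`_(size p).-1 = 1 := monicP mon_p.
case: (size p) (monic_neq0 mon_p) (size_poly_eq0 p) => [|[|n]] nz_p /=.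
- by rewrite eqxx (negPf nz_p).
- move=> _ lead1; rewrite big_ord1 coef_map /= lead1 rmorph1 mul1r expr0.
  by move/eqP; rewrite oner_eq0.
move=> _ lead1 root_p.
exists (- \sum_(i < n.+1) p`_i * d ^+ (n - i)).
move: root_p; rewrite big_ord_recr /= coef_map /= lead1 rmorph1 mul1r.
move/(congr1 (fun y => y * f d ^+ n)); rewrite mul0r mulrDl mulr_suml.
rewrite [_^-1 ^+ n.+1]exprS -mulrA exprVn mulVf ?expf_neq0 // mulr1.
move/eqP; rewrite addrC addr_eq0 => /eqP ->; rewrite rmorphN rmorph_sum /=.
congr (- _); apply: eq_bigr => i _.
rewrite coef_map rmorphM rmorphXn /= -mulrA; congr (_ * _).
have le_in : (i <= n)%N by rewrite -ltnS.
have -> : f d ^+ n = f d ^+ i * f d ^+ (n - i) by rewrite -exprD subnKC.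
by rewrite mulrA exprVn mulVf ?expf_neq0 // mul1r.
Qed.

Theorem corollary65 (R : idomainType) : is_PID R -> is_dedekind R.
Proof.
move=> pidR; split; first exact: pid_noetherian.
- move=> z int_z.
  have [n [d [u [v [nz_d bezout def_z]]]]] := pid_reduced_fraction z pidR.
  have nz_fd : tofrac d != 0 by rewrite tofrac_eq0.
  have def_inv : (tofrac d)^-1 = z * tofrac u + tofrac v.
    apply: (mulIf nz_fd); rewrite mulVf // mulrDl mulrAC def_z divfK //.
    by rewrite -!rmorphM -rmorphD /= [v * d]mulrC bezout rmorph1.
  have [|r def_r] := @integral_inv_in_ring _ _ (@tofrac R) d nz_fd.
    rewrite def_inv; apply: integral_add; last exact: integral_id.
    by apply: integral_mul; last exact: integral_id.
  by exists (n * r); rewrite def_z def_r rmorphM.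
- by move=> P; apply: pid_prime_maximal.
Qed.
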